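(* Let $m,n,d\ge 1$ and let $X_i, f_i$ ($i=1,\dots,m$), $Y_i,g_i$ ($i=1,\dots,n$) satisfy the standing assumptions 1–3 listed in the context. Let $z^*$ be the optimal solution of the problem $F(z)\to\max_{z\in S}$ and let $\lambda^*$ be an optimal solution of the dual problem $G(\lambda)\to\min_{\lambda\in\mathbb R^d}$. Let $\lambda_t$ be generated by the SOLO FTRL algorithm $$\lambda_1=0,\qquad \lambda_t=-\frac{\sum_{j=1}^{t-1}\Delta\widetilde z(\lambda_j)}{\sqrt{\sum_{j=1}^{t-1}\|\Delta\widetilde z(\lambda_j)\|^2}},\quad t\ge 2,$$ and let $\overline\lambda_T=\frac1T\sum_{t=1}^T\lambda_t$. Then for all $T\ge 1$ $$F(z^* )-F(\widetilde z(\overline\lambda_T))\le K\sqrt{\frac{(m+n)c}{\sigma}}\,\sqrt{\|\lambda^*\|^2+12.5}\;\frac{d^{1/4}}{T^{1/4}},$$ $$\|\Delta\widetilde z(\overline\lambda_T)\|\le\sqrt{\kappa(m+n)c}\,\sqrt{\|\lambda^*\|^2+12.5}\;\frac{d^{1/4}}{T^{1/4}}.$$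
   Context: Notation: $\mathbb R^d_+=\{x\in\mathbb R^d: x\ge 0 \text{ componentwise}\}$, $\langle\cdot,\cdot\rangle$ is the usual scalar product and $\|\cdot\|$ the Euclidean norm. A function $f:A\to\mathbb R$ on a convex set $A$ is $\sigma$-strongly convex ($\sigma>0$) if $f(\alpha x+(1-\alpha)y)\le\alpha f(x)+(1-\alpha)f(y)-\frac{\sigma}{2}\alpha(1-\alpha)\|x-y\|^2$ for all $x,y\in A$, $\alpha\in[0,1]$; $f$ is $\sigma$-strongly concave if $-f$ is $\sigma$-strongly convex. Standing assumptions. 1. The sets $X_i$ ($i=1,\dots,m$) and $Y_i$ ($i=1,\dots,n$) are convex, compact subsets of $\mathbb R^d_+$, and $[0,\varepsilon]^d\subset X_i\subset[0,c]^d$, $[0,\varepsilon]^d\subset Y_i\subset[0,c]^d$ with some $\varepsilon>0$, $c>0$. 2. The functions $f_i:X_i\to\mathbb R_+$ are $\sigma_i'$-strongly concave and the functions $g_i:Y_i\to\mathbb R_+$ are $\sigma_i''$-strongly convex ($\sigma_i',\sigma_i''>0$); all are non-decreasing in each argument, and $f_i(0)=g_i(0)=0$. 3. The functions $f_i$ are $K_i'$-Lipschitz and the functions $g_i$ are $K_i''$-Lipschitz. Definitions. $Z=\prod_{i=1}^m X_i\times\prod_{j=1}^n Y_j$, $S=\{(x,y)\in Z:\sum_{i=1}^m x_i=\sum_{j=1}^n y_j\}$, and $F(x,y)=\sum_{i=1}^m f_i(x_i)-\sum_{i=1}^n g_i(y_i)$ for $(x,y)\in Z$. For $\lambda\in\mathbb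 R^d$, $$\widetilde x_i(\lambda)=\arg\max_{x_i\in X_i}(f_i(x_i)-\langle\lambda,x_i\rangle),\qquad \widetilde y_i(\lambda)=\arg\max_{y_i\in Y_i}(\langle\lambda,y_i\rangle-g_i(y_i))$$ (unique maximizers), $\widetilde z(\lambda)=(\widetilde x(\lambda),\widetilde y(\lambda))$, and $$\Delta\widetilde z(\lambda)=\sum_{i=1}^n\widetilde y_i(\lambda)-\sum_{i=1}^m\widetilde x_i(\lambda).$$ The dual objective is $G(\lambda)=\sup_{(x,y)\in Z}\left(F(x,y)+\sum_{i=1}^n\langle\lambda,y_i\rangle-\sum_{i=1}^m\langle\lambda,x_i\rangle\right)$; it is differentiable with $\nabla G(\lambda)=\Delta\widetilde z(\lambda)$, and the dual problem is solvable. Under the assumptions $\Delta\widetilde z(0)\ne 0$, so the denominators in the algorithm are non-zero. Constants: $$\sigma=\min\left\{\min_{1\le i\le m}\sigma_i',\min_{1\le i\le n}\sigma_i''\right\},\quad K=\left(\sum_{i=1}^m(K_i')^2+\sum_{i=1}^n(K_i'')^2\right)^{1/2},\quad \kappa=\sum_{i=1}^m\frac1{\sigma_i'}+\sum_{i=1}^n\frac1{\sigma_i''}.$$ *)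

(* Defs.v *)
From HB Require Import structures.
From mathcomp Require Export all_boot all_order all_algebra.
From mathcomp Require Export all_classical all_reals all_analysis.
Export Order.TTheory GRing.Theory Num.Theory numFieldNormedType.Exports.

Set Implicit Arguments.
Unset Strict Implicit.
Unset Printing Implicit Defensive.

Local Open Scope classical_set_scope.
Local Open Scope ring_scope.

Definition dot (R : realType) (d : nat) (u v : 'rV[R]_d) : R :=
  \sum_(k < d) u 0 k * v 0 k.

(* The library norm `|x| on 'rV[R]_d is the sup norm, hence this definition.
   Both norms induce the topology used by [compact]. *)
Definition enorm (R : realType) (d : nat) (u : 'rV[R]_d) : R :=
  Num.sqrt (dot u u).

Definition orthant (R : realType) (d : nat) : set 'rV[R]_d :=
  [set x | forall k, 0 <= x 0 k].

Definition cube (R : realType) (d : nat) (a : R) : set 'rV[R]_d :=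
  [set x | forall k, 0 <= x 0 k <= a].

(* Functions on A are encoded as total functions; only values on A matter. *)
Definition strongly_convex_on (R : realType) (d : nat) (s : R)
    (A : set 'rV[R]_d) (f : 'rV[R]_d -> R) : Prop :=
  forall (x y : 'rV[R]_d) (a : R), A x -> A y -> 0 <= a <= 1 ->
    f (a *: x + (1 - a) *: y) <=
      a * f x + (1 - a) * f y - s / 2 * a * (1 - a) * enorm (x - y) ^+ 2.

Definition strongly_concave_on (R : realType) (d : nat) (s : R)
    (A : set 'rV[R]_d) (f : 'rV[R]_d -> R) : Prop :=
  strongly_convex_on s A (fun x => - f x).

Definition nondecreasing_in_each_arg (R : realType) (d : nat)
    (A : set 'rV[R]_d) (f : 'rV[R]_d -> R) : Prop :=
  forall (k : 'I_d) (x y : 'rV[R]_d), A x -> A y ->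
    (forall l, l != k -> x 0 l = y 0 l) -> x 0 k <= y 0 k -> f x <= f y.

Definition elipschitz_on (R : realType) (d : nat) (K : R)
    (A : set 'rV[R]_d) (f : 'rV[R]_d -> R) : Prop :=
  forall x y : 'rV[R]_d, A x -> A y -> `|f x - f y| <= K * enorm (x - y).

Definition is_maximizer (R : realType) (T : Type) (A : set T) (h : T -> R)
    (x : T) : Prop :=
  A x /\ forall y, A y -> h y <= h x.

(* Default value 0 when no maximizer exists. *)
Definition argmax (R : realType) (d : nat) (A : set 'rV[R]_d)
    (h : 'rV[R]_d -> R) : 'rV[R]_d :=
  xget 0 [set x | is_maximizer A h x].

Definition profile (R : realType) (m n d : nat) : Type :=
  (('I_m -> 'rV[R]_d) * ('I_n -> 'rV[R]_d))%type.

Definition Zset (R : realType) (m n d : nat)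
    (X : 'I_m -> set 'rV[R]_d) (Y : 'I_n -> set 'rV[R]_d) :
    set (profile R m n d) :=
  [set z | (forall i, X i (z.1 i)) /\ (forall j, Y j (z.2 j))].

Definition Sset (R : realType) (m n d : nat)
    (X : 'I_m -> set 'rV[R]_d) (Y : 'I_n -> set 'rV[R]_d) :
    set (profile R m n d) :=
  [set z | Zset X Y z /\ \sum_(i < m) z.1 i = \sum_(j < n) z.2 j].

Definition objF (R : realType) (m n d : nat)
    (f : 'I_m -> 'rV[R]_d -> R) (g : 'I_n -> 'rV[R]_d -> R)
    (z : profile R m n d) : R :=
  \sum_(i < m) f i (z.1 i) - \sum_(j < n) g j (z.2 j).

Definition xtilde (R : realType) (m d : nat)
    (X : 'I_m -> set 'rV[R]_d) (f : 'I_m -> 'rV[R]_d -> R)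
    (lam : 'rV[R]_d) (i : 'I_m) : 'rV[R]_d :=
  argmax (X i) (fun x => f i x - dot lam x).

Definition ytilde (R : realType) (n d : nat)
    (Y : 'I_n -> set 'rV[R]_d) (g : 'I_n -> 'rV[R]_d -> R)
    (lam : 'rV[R]_d) (j : 'I_n) : 'rV[R]_d :=
  argmax (Y j) (fun y => dot lam y - g j y).

Definition ztilde (R : realType) (m n d : nat)
    (X : 'I_m -> set 'rV[R]_d) (Y : 'I_n -> set 'rV[R]_d)
    (f : 'I_m -> 'rV[R]_d -> R) (g : 'I_n -> 'rV[R]_d -> R)
    (lam : 'rV[R]_d) : profile R m n d :=
  (xtilde X f lam, ytilde Y g lam).

Definition Delta_ztilde (R : realType) (m n d : nat)
    (X : 'I_m -> set 'rV[R]_d) (Y : 'I_n -> set 'rV[R]_d)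
    (f : 'I_m -> 'rV[R]_d -> R) (g : 'I_n -> 'rV[R]_d -> R)
    (lam : 'rV[R]_d) : 'rV[R]_d :=
  \sum_(j < n) ytilde Y g lam j - \sum_(i < m) xtilde X f lam i.

(* Real-valued [sup]: over compact X i, Y j and Lipschitz f i, g j the set of
   values is bounded, so the junk value of [sup] is not reached. *)
Definition dualG (R : realType) (m n d : nat)
    (X : 'I_m -> set 'rV[R]_d) (Y : 'I_n -> set 'rV[R]_d)
    (f : 'I_m -> 'rV[R]_d -> R) (g : 'I_n -> 'rV[R]_d -> R)
    (lam : 'rV[R]_d) : R :=
  sup [set objF f g z + \sum_(j < n) dot lam (z.2 j)
           - \sum_(i < m) dot lam (z.1 i) | z in Zset X Y].

(* Iterates are numbered from 1; lam 0 is unconstrained. *)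
Definition solo_ftrl (R : realType) (m n d : nat)
    (X : 'I_m -> set 'rV[R]_d) (Y : 'I_n -> set 'rV[R]_d)
    (f : 'I_m -> 'rV[R]_d -> R) (g : 'I_n -> 'rV[R]_d -> R)
    (lam : nat -> 'rV[R]_d) : Prop :=
  lam 1%N = 0 /\
  forall t : nat, (2 <= t)%N ->
    lam t = - ((Num.sqrt (\sum_(1 <= j < t)
                  enorm (Delta_ztilde X Y f g (lam j)) ^+ 2))^-1 *:
               \sum_(1 <= j < t) Delta_ztilde X Y f g (lam j)).

Definition average (R : realType) (d : nat) (lam : nat -> 'rV[R]_d) (T : nat) :
    'rV[R]_d :=
  T%:R^-1 *: \sum_(1 <= t < T.+1) lam t.

(* The minimum of a nonempty finite family; folding from the value at index 0
   avoids a neutral element for min. *)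
Definition family_min (R : realType) (k : nat) (hk : (0 < k)%N)
    (s : 'I_k -> R) : R :=
  \big[Num.min/s (Ordinal hk)]_(i < k) s i.

Definition sigma_min (R : realType) (m n : nat) (hm : (0 < m)%N)
    (hn : (0 < n)%N) (s1 : 'I_m -> R) (s2 : 'I_n -> R) : R :=
  Num.min (family_min hm s1) (family_min hn s2).

Definition Kconst (R : realType) (m n : nat) (K1 : 'I_m -> R) (K2 : 'I_n -> R)
    : R :=
  Num.sqrt (\sum_(i < m) K1 i ^+ 2 + \sum_(j < n) K2 j ^+ 2).

Definition kappa (R : realType) (m n : nat) (s1 : 'I_m -> R) (s2 : 'I_n -> R)
    : R :=
  \sum_(i < m) (s1 i)^-1 + \sum_(j < n) (s2 j)^-1.

(* Main.v *)
Require Import Defs.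
From mathcomp Require Import ring lra.
Set Implicit Arguments.
Unset Strict Implicit.
Unset Printing Implicit Defensive.


(* Write L(z, lam) = F(z) + <lam, residual z>, so that G(lam) is the maximum of
   L(., lam), attained at ztilde(lam). Strong concavity gives
     L(z, lam) <= G(lam) - Q(z, ztilde(lam)) / 2,
   where Q is the squared distance weighted by the moduli. A minimizer lamstar
   of G satisfies Delta_ztilde(lamstar) = 0, hence G(lamstar) <= F(zstar), and
   taking z = zstar yields Q(zstar, ztilde(lam)) / 2 <= G(lam) - G(lamstar).
   Both claimed bounds are Cauchy-Schwarz estimates in terms of Q. By convexity
   of G, its gap at the average iterate is at most the average regret of FTRL
   against lamstar on the losses Delta_ztilde(lam_t), whose norms are at most
   (m + n) c sqrt d; that regret is bounded by a telescoping potential. *)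

Local Open Scope classical_set_scope.
Local Open Scope ring_scope.

(** * Bilinearity and positivity of the scalar product *)

Section Dot.
Context {R : realType} {d : nat}.
Implicit Types u v w : 'rV[R]_d.

Lemma dotC u v : dot u v = dot v u.
Proof. by apply: eq_bigr => k _; rewrite mulrC. Qed.

Lemma dotDl u v w : dot (u + v) w = dot u w + dot v w.
Proof. by rewrite /dot -big_split; apply: eq_bigr => k _; rewrite mxE mulrDl. Qed.

Lemma dotZl a u v : dot (a *: u) v = a * dot u v.
Proof. by rewrite /dot mulr_sumr; apply: eq_bigr => k _; rewrite mxE mulrA. Qed.

Lemma dotNl u v : dot (- u) v = - dot u v.
Proof. by rewrite -scaleN1r dotZl mulN1r. Qed.

Lemma dotDr u v w : dot u (v + w) = dot u v + dot u w.
Proof. by rewrite dotC dotDl !(dotC u). Qed.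

Lemma dotZr a u v : dot u (a *: v) = a * dot u v.
Proof. by rewrite dotC dotZl dotC. Qed.

Lemma dotNr u v : dot u (- v) = - dot u v.
Proof. by rewrite dotC dotNl dotC. Qed.

Lemma dot0l u : dot 0 u = 0.
Proof. by rewrite -(scale0r 0) dotZl mul0r. Qed.

Lemma dot0r u : dot u 0 = 0.
Proof. by rewrite dotC dot0l. Qed.

Definition dotE := (dotDl, dotDr, dotNl, dotNr, dotZl, dotZr).

Lemma dot_suml (I : Type) (r : seq I) (P : pred I) (F : I -> 'rV[R]_d) u :
  dot (\sum_(i <- r | P i) F i) u = \sum_(i <- r | P i) dot (F i) u.
Proof. by apply: (big_morph (fun x => dot x u)) => [x y|]; rewrite ?dotDl ?dot0l. Qed.

Lemma dot_sumr (I : Type) (r : seq I) (P : pred I) (F : I -> 'rV[R]_d) u :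
  dot u (\sum_(i <- r | P i) F i) = \sum_(i <- r | P i) dot u (F i).
Proof. by rewrite dotC dot_suml; apply: eq_bigr => i _; rewrite dotC. Qed.

Lemma dot_sqr u : dot u u = \sum_(k < d) u 0 k ^+ 2.
Proof. by apply: eq_bigr => k _; rewrite expr2. Qed.

Lemma dot_ge0 u : 0 <= dot u u.
Proof. by apply: sumr_ge0 => k _; rewrite -expr2 sqr_ge0. Qed.

Lemma dot_eq0 u : dot u u = 0 -> u = 0.
Proof.
move/psumr_eq0P => u0; apply/rowP => k; rewrite mxE.
apply/eqP; rewrite -sqrf_eq0 expr2 u0 // => i _.
by rewrite -expr2 sqr_ge0.
Qed.

Lemma enorm_ge0 u : 0 <= enorm u.
Proof. exact: sqrtr_ge0. Qed.

Lemma sqr_enorm u : enorm u ^+ 2 = dot u u.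
Proof. by rewrite sqr_sqrtr // dot_ge0. Qed.

End Dot.

(** * Cauchy-Schwarz inequalities, plain and weighted *)

Section CauchySchwarz.
Context {R : realType}.

Lemma cauchy_schwarz (I : finType) (a b : I -> R) :
  (\sum_i a i * b i) ^+ 2 <= (\sum_i a i ^+ 2) * (\sum_i b i ^+ 2).
Proof.
set r := \sum_i a i * b i; set p := \sum_i a i ^+ 2; set q := \sum_i b i ^+ 2.
have q0 : 0 <= q by apply: sumr_ge0 => i _; exact: sqr_ge0.
have key : 0 <= q * (q * p - r ^+ 2).
  have -> : q * (q * p - r ^+ 2) = \sum_i (q * a i - r * b i) ^+ 2.
    under eq_bigr => i _.
      have -> : (q * a i - r * b i) ^+ 2 =
        q ^+ 2 * a i ^+ 2 + (- (2 * q * r) * (a i * b i) + r ^+ 2 * b i ^+ 2) by ring.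
      over.
    by rewrite !big_split /= -!mulr_sumr -/r -/p -/q; ring.
  by apply: sumr_ge0 => i _; exact: sqr_ge0.
have [q_eq0|qn0] := eqVneq q 0.
  have b0 i : b i = 0.
    apply/eqP; rewrite -sqrf_eq0; apply/eqP.
    have /psumr_eq0P := q_eq0.
    by apply=> // j _; exact: sqr_ge0.
  have -> : r = 0 by rewrite /r big1 // => i _; rewrite b0 mulr0.
  by rewrite expr0n /= q_eq0 mulr0.
have q_gt0 : 0 < q by rewrite lt_neqAle eq_sym qn0.
by move: key; rewrite pmulr_rge0 // subr_ge0 mulrC.
Qed.

(** Cauchy-Schwarz for the families [(s i)^(-1/2)] and [(s i)^(1/2) b i]. *)
Lemma weighted_cauchy_schwarz (I : finType) (s b : I -> R) :
  (forall i, 0 < s i) ->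
  (\sum_i b i) ^+ 2 <= (\sum_i (s i)^-1) * (\sum_i s i * b i ^+ 2).
Proof.
move=> s0.
have sq i : Num.sqrt (s i) ^+ 2 = s i by rewrite sqr_sqrtr // ltW.
have sn0 i : Num.sqrt (s i) != 0 by rewrite gt_eqF // sqrtr_gt0.
have := cauchy_schwarz (fun i => (Num.sqrt (s i))^-1) (fun i => Num.sqrt (s i) * b i).
under eq_bigr => i _ do rewrite mulKf //.
under [X in _ <= X * _]eq_bigr => i _ do rewrite exprVn sq.
by under [X in _ <= _ * X]eq_bigr => i _ do rewrite exprMn sq.
Qed.

(** The weighted inequality in each coordinate. The weights are the moduli in [residual_dist2] and 1
    in [ftrl_regret]. *)
Lemma dot_sum_le (I : finType) (d : nat) (s : I -> R) (v : I -> 'rV[R]_d) :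
  (forall i, 0 < s i) ->
  dot (\sum_i v i) (\sum_i v i) <=
    (\sum_i (s i)^-1) * \sum_i s i * dot (v i) (v i).
Proof.
move=> s0; under [X in _ <= _ * X]eq_bigr => i _ do rewrite mulr_sumr.
rewrite exchange_big /= mulr_sumr; apply: ler_sum => k _.
rewrite -expr2 summxE (le_trans (weighted_cauchy_schwarz _ s0)) //.
Qed.

Lemma le_sqrtr_sqr (x y : R) : x ^+ 2 <= y -> x <= Num.sqrt y.
Proof.
move=> xy; rewrite (le_trans (ler_norm x)) // -sqrtr_sqr ler_sqrt //.
exact: le_trans (sqr_ge0 x) xy.
Qed.

Lemma dot_le_enorm d (u v : 'rV[R]_d) : dot u v <= enorm u * enorm v.
Proof.
rewrite -sqrtrM ?dot_ge0 // le_sqrtr_sqr //.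
rewrite !dot_sqr; exact: (cauchy_schwarz (fun k => u 0 k) (fun k => v 0 k)).
Qed.

Lemma norm_dot_le_enorm d (u v : 'rV[R]_d) : `|dot u v| <= enorm u * enorm v.
Proof.
rewrite ler_norml dot_le_enorm andbT lerNl -dotNl.
by rewrite (le_trans (dot_le_enorm _ _)) // /enorm !dotE opprK.
Qed.

(** Lets Lipschitz bounds in [enorm] control the topology, which comes from the sup norm. *)
Lemma enorm_le_norm d (u : 'rV[R]_d) : enorm u <= Num.sqrt d%:R * `|u|.
Proof.
rewrite -[X in _ <= _ * X]ger0_norm // -[in leRHS]sqrtr_sqr -sqrtrM // ler_sqrt; last first.
  by rewrite mulr_ge0 ?sqr_ge0.
apply: (@le_trans _ _ (\sum_(k < d) `|u| ^+ 2)).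
  apply: ler_sum => k _; rewrite -expr2 -real_normK ?num_real //.
  by rewrite ler_sqr ?nnegrE // [leRHS]/Num.norm /= mx_normrE (le_bigmax _ _ (0, k)).
by rewrite sumr_const card_ord mulr_natl.
Qed.

End CauchySchwarz.

(** * Existence of maximizers and quadratic decrease away from them *)

Section Maximizers.
Context {R : realType} {d : nat}.
Implicit Types (A : set 'rV[R]_d) (h : 'rV[R]_d -> R) (x y lam : 'rV[R]_d).

Lemma elipschitz_within_continuous K A h :
  elipschitz_on K A h -> {within A, continuous h}.
Proof.
move=> hlip; apply/subspace_continuousP => x Ax.
apply/cvgrPdist_le => e e0.
(* The summand 1 keeps [C] positive when [K] or [d] is zero. *)
pose C := `|K| * Num.sqrt d%:R + 1.
have C0 : 0 < C by rewrite ltr_wpDl // mulr_ge0 // sqrtr_ge0.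
have eC : 0 < e / C by rewrite divr_gt0.
apply/nbhs_ballP; exists (e / C) => //= y.
rewrite -ball_normE /= => xy Ay.
apply: (le_trans (hlip _ _ Ax Ay)).
apply: (@le_trans _ _ (`|K| * (Num.sqrt d%:R * `|x - y|))).
  rewrite (@le_trans _ _ (`|K| * enorm (x - y))) //.
    by rewrite ler_wpM2r ?enorm_ge0 ?ler_norm.
  by rewrite ler_wpM2l // enorm_le_norm.
rewrite mulrA -(divfK (lt0r_neq0 C0) e) mulrC ler_pM ?mulr_ge0 ?sqrtr_ge0 //.
  exact: ltW.
by rewrite /C lerDl.
Qed.

Lemma compact_maximizer K A h :
  A !=set0 -> compact A -> elipschitz_on K A h ->
  is_maximizer A h (argmax A h).
Proof.
move=> A0 cA hlip; apply: (xgetPex 0).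
have [x xA xmax] := compact_EVT_max A0 cA (elipschitz_within_continuous hlip).
by exists x; split=> [|y Ay]; [exact: set_mem | apply: xmax; exact: mem_set].
Qed.

(** Compare [x] with the point [a *: y + (1 - a) *: x] of [A], divide by [a] and let [a] tend to
    0. *)
Lemma maximizer_gap (s : R) A h x y :
  0 <= s -> convex_set A -> strongly_concave_on s A h -> is_maximizer A h x ->
  A y -> s / 2 * dot (y - x) (y - x) <= h x - h y.
Proof.
move=> s0 cA hs [Ax xmax] Ay; set D := dot _ _.
have D0 : 0 <= D := dot_ge0 _.
have step a : 0 < a -> a <= 1 -> s / 2 * (1 - a) * D <= h x - h y.
  move=> a0 a1.
  have a01 : 0 <= a <= 1 by rewrite ltW.
  have /xmax hle : A (a *: y + (1 - a) *: x).
    have := cA y x (Itv01 (ltW a0) a1) (mem_set Ay) (mem_set Ax).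
    by move/set_mem.
  have := hs y x a Ay Ax a01; rewrite sqr_enorm -/D => hc.
  have : a * (s / 2 * (1 - a) * D) <= a * (h x - h y) by lra.
  by rewrite ler_pM2l.
have [//|lt] := leP (s / 2 * D) (h x - h y).
have hxy0 : 0 <= h x - h y by rewrite subr_ge0 xmax.
pose E := s / 2 * D.
have E0 : 0 < E := le_lt_trans hxy0 lt.
(* An explicit [a] replaces the limit: it makes [(1 - a) * E] the midpoint of [E] and [h x - h y],
   which still exceeds [h x - h y] and contradicts [step]. *)
pose a := (E - (h x - h y)) / (2 * E).
have a0 : 0 < a by rewrite divr_gt0 ?subr_gt0 // mulr_gt0.
have aE : a * E = (E - (h x - h y)) / 2 by rewrite /a; field; rewrite gt_eqF.
have a1 : a <= 1 by rewrite ler_pdivrMr; lra.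
have := step a a0 a1.
have -> : s / 2 * (1 - a) * D = E - a * E by rewrite /E; ring.
rewrite aE => ?; move: lt; rewrite -/E; lra.
Qed.

Lemma strongly_concave_subl s A h lam :
  strongly_concave_on s A h -> strongly_concave_on s A (fun x => h x - dot lam x).
Proof.
move=> hs x y a Ax Ay a01; have := hs x y a Ax Ay a01.
by rewrite /= !dotE; lra.
Qed.

Lemma strongly_convex_subl s A h lam :
  strongly_convex_on s A h -> strongly_concave_on s A (fun x => dot lam x - h x).
Proof.
move=> hs x y a Ax Ay a01; have := hs x y a Ax Ay a01.
by rewrite /= !dotE; lra.
Qed.

Lemma elipschitz_subl K A h lam :
  elipschitz_on K A h ->
  elipschitz_on (K + enorm lam) A (fun x => h x - dot lam x).
Proof.
move=> hl x y Ax Ay.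
have -> : h x - dot lam x - (h y - dot lam y) = (h x - h y) - dot lam (x - y).
  by rewrite !dotE; ring.
by rewrite (le_trans (ler_normB _ _)) // mulrDl lerD ?hl ?norm_dot_le_enorm.
Qed.

Lemma elipschitz_subr K A h lam :
  elipschitz_on K A h ->
  elipschitz_on (K + enorm lam) A (fun x => dot lam x - h x).
Proof.
move=> hl x y Ax Ay; have := elipschitz_subl lam hl Ax Ay.
by rewrite -normrN; congr (`|_| <= _); ring.
Qed.

End Maximizers.

(** * Regret of follow-the-regularized-leader with adaptive scaling *)

Section Regret.
Context {R : realType} {d : nat}.
Implicit Types (u v S : 'rV[R]_d) (l w : nat -> 'rV[R]_d).

(* The increment of the potential [|S|^2 / (2 eta)] plus the loss incurred.
   If [q <= 2 p] it is at most [|v|^2 / (2 p)]; if [q > 2 p] then [|v|] is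
   comparable to [q], and the geometric growth of such [q] is recorded by the
   truncated potential [min eta (3/2 B)]. The bound holds for [p = 0] or [q = 0]
   too, as then [S = 0] and division by zero gives zero. *)
Lemma regret_step S v (p q N B : R) :
  0 <= p -> 0 <= q -> 0 <= N -> 0 <= B ->
  q ^+ 2 = p ^+ 2 + dot v v -> dot S S <= (N * p) ^+ 2 -> dot v v <= B ^+ 2 ->
  dot (S + v) (S + v) / (2 * q) - dot S S / (2 * p) - dot v S / p <=
    2 * (q - p) + 2 * N * (Num.min q (3 / 2 * B) - Num.min p (3 / 2 * B)).
Proof.
move=> p0 q0 N0 B0 qE SN vB.
have pq : p <= q by rewrite -ler_sqr ?nnegrE // qE lerDl dot_ge0.
have min_pq : 0 <= Num.min q (3 / 2 * B) - Num.min p (3 / 2 * B).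
  by rewrite subr_ge0 le_min !ge_min pq lexx orbT.
have [p_eq0|pn0] := eqVneq p 0.
  have S0 : S = 0.
    apply: dot_eq0; apply/eqP; rewrite eq_le dot_ge0 andbT.
    by rewrite (le_trans SN) // p_eq0 mulr0 expr0n.
  move: min_pq qE; rewrite S0 add0r !dot0r !mul0r !subr0 p_eq0 subr0 => min_pq qE.
  rewrite expr0n /= add0r in qE; rewrite -qE.
  apply: (@le_trans _ _ (2 * q)); last by rewrite lerDl mulr_ge0 ?mulr_ge0.
  have [->|qn0] := eqVneq q 0; first by rewrite expr0n /= mul0r mulr0.
  have -> : q ^+ 2 / (2 * q) = q / 2 by field.
  lra.
have p_gt0 : 0 < p by rewrite lt_neqAle eq_sym pn0.
have q_gt0 : 0 < q := lt_le_trans p_gt0 pq.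
have [q_le2p|q_gt2p] := leP q (2 * p).
  apply: (@le_trans _ _ (2 * (q - p))); last by rewrite lerDl mulr_ge0 ?mulr_ge0.
  (* Replacing [2 * q] by [2 * p] leaves [|v|^2 / (2 p)], where [|v|^2 = (q - p)(q + p)] and
     [q + p <= 4 p]. *)
  apply: (@le_trans _ _ (dot v v / (2 * p))).
    have -> : dot v v / (2 * p) =
        dot (S + v) (S + v) / (2 * p) - dot S S / (2 * p) - dot v S / p.
      by rewrite !dotE (dotC S v); field.
    rewrite !lerB // ler_wpM2l ?dot_ge0 // lef_pV2 ?posrE ?mulr_gt0 //.
    by rewrite ler_pM2l.
  rewrite ler_pdivrMr ?mulr_gt0 //.
  have -> : dot v v = (q - p) * (q + p) by rewrite -subr_sqr qE; ring.
  have -> : 2 * (q - p) * (2 * p) = (q - p) * (4 * p) by ring.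
  by rewrite ler_wpM2l ?subr_ge0 //; lra.
have v_le_q : enorm v <= q.
  by rewrite -ler_sqr ?nnegrE ?enorm_ge0 // sqr_enorm qE lerDr sqr_ge0.
(* Here [q^2 = p^2 + |v|^2 < q^2 / 4 + B^2], so [q^2 < 4/3 B^2]; the 3/2 is a rational upper bound
   for the root of 4/3. Neither minimum is then truncated. *)
have q_leB : q <= 3 / 2 * B.
  rewrite -ler_sqr ?nnegrE ?mulr_ge0 //.
  have : (2 * p) ^+ 2 <= q ^+ 2 by rewrite ler_sqr ?nnegrE ?mulr_ge0 // ltW.
  rewrite !exprMn; have := sqr_ge0 B; lra.
rewrite (min_idPl q_leB) (min_idPl (le_trans pq q_leB)).
have SNp : enorm S <= N * p.
  by rewrite -ler_sqr ?nnegrE ?enorm_ge0 ?mulr_ge0 // sqr_enorm.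
have vS : - dot v S <= q * (N * p).
  rewrite -dotNl (le_trans (dot_le_enorm _ _)) // {1}/enorm !dotE opprK -/(enorm v).
  by rewrite ler_pM ?enorm_ge0.
have iqp : 0 <= p^-1 - q^-1 by rewrite subr_ge0 lef_pV2.
have -> : dot (S + v) (S + v) / (2 * q) - dot S S / (2 * p) - dot v S / p =
    dot v v / (2 * q) - dot S S / 2 * (p^-1 - q^-1) + - dot v S * (p^-1 - q^-1).
  by rewrite !dotE (dotC S v); field; rewrite !gt_eqF.
(* The first term is at most [q - p], the second is subtracted and nonnegative, and the third is at
   most [N * (q - p)]. *)
apply: (@le_trans _ _ ((q - p) + q * (N * p) * (p^-1 - q^-1))).
  rewrite lerD ?ler_wpM2r //.
  apply: (@le_trans _ _ (dot v v / (2 * q))).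
    by rewrite lerBlDr lerDl mulr_ge0 ?divr_ge0 ?dot_ge0.
  rewrite ler_pdivrMr ?mulr_gt0 //.
  have -> : dot v v = (q - p) * (q + p) by rewrite -subr_sqr qE; ring.
  by rewrite ler_wpM2l ?subr_ge0 //; lra.
have -> : q * (N * p) * (p^-1 - q^-1) = N * (q - p).
  by field; rewrite !gt_eqF.
have : 0 <= N * (q - p) by rewrite mulr_ge0 // subr_ge0.
lra.
Qed.

(** Summing [regret_step] bounds loss plus final potential by [2 e(T) + 3 N B <= 5 B N]. Fenchel's
    inequality trades that potential for the comparator [u], at the cost [e(T) |u|^2 / 2]. *)
Lemma ftrl_regret l w (T : nat) (B : R) u :
  0 <= B -> (forall t, dot (l t) (l t) <= B ^+ 2) ->
  (forall t, w t = - ((Num.sqrt (\sum_(i < t) dot (l i) (l i)))^-1 *: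
                      \sum_(i < t) l i)) ->
  \sum_(t < T) dot (l t) (w t - u) <=
    B * Num.sqrt T%:R * (dot u u / 2 + 5).
Proof.
move=> B0 lB wE.
pose S t := \sum_(i < t) l i.
pose e t := Num.sqrt (\sum_(i < t) dot (l i) (l i)).
have sum_ge0 t : 0 <= \sum_(i < t) dot (l i) (l i).
  by apply: sumr_ge0 => i _; exact: dot_ge0.
have e0 t : 0 <= e t := sqrtr_ge0 _.
have e2 t : e t ^+ 2 = \sum_(i < t) dot (l i) (l i) by rewrite sqr_sqrtr.
have N0 : 0 <= Num.sqrt T%:R :> R := sqrtr_ge0 _.
set N := Num.sqrt T%:R in N0 *.
(* Cauchy-Schwarz with unit weights gives [|S t|^2 <= t (e t)^2], and [t <= T = N^2]. *)
have SN t : (t <= T)%N -> dot (S t) (S t) <= (N * e t) ^+ 2.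
  move=> tT; have /= := @dot_sum_le _ 'I_t _ (fun=> 1) (fun i => l i) (fun=> ltr01).
  under [X in _ * X]eq_bigr => i _ do rewrite mul1r.
  move/le_trans; apply.
  rewrite exprMn e2 sqr_sqrtr // (ler_wpM2r (sum_ge0 t)) //.
  by rewrite sumr_const card_ord invr1 ler_nat.
have potential t : (t <= T)%N ->
    dot (S t) (S t) / (2 * e t) + \sum_(i < t) dot (l i) (w i) <=
      2 * e t + 2 * N * Num.min (e t) (3 / 2 * B).
  elim: t => [_|t IH tT].
    rewrite /S !big_ord0 dot0l mul0r add0r.
    have -> : e 0%N = 0 by rewrite /e big_ord0 sqrtr0.
    by rewrite mulr0 add0r mulr_ge0 ?mulr_ge0 // le_min lexx mulr_ge0.
  have := IH (ltnW tT).
  have e2S : e t.+1 ^+ 2 = e t ^+ 2 + dot (l t) (l t).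
    by rewrite !e2 big_ord_recr.
  have := regret_step (e0 t) (e0 t.+1) N0 B0 e2S (SN t (ltnW tT)) (lB t).
  rewrite [\sum_(i < t.+1) _]big_ord_recr /= wE -/(S t) -/(e t).
  have -> : S t.+1 = S t + l t by rewrite /S big_ord_recr.
  by rewrite [dot (l t) (- _)]dotNr dotZr (mulrC (e t)^-1); lra.
have eT : e T <= B * N.
  rewrite -ler_sqr ?nnegrE ?mulr_ge0 // exprMn e2 sqr_sqrtr //.
  apply: (@le_trans _ _ (\sum_(i < T) B ^+ 2)); first exact: ler_sum.
  by rewrite sumr_const card_ord mulr_natr.
have fenchel : - dot (S T) u <= dot (S T) (S T) / (2 * e T) + e T * (dot u u / 2).
  have [eT0|eTn0] := eqVneq (e T) 0.
    have -> : S T = 0.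
      apply: dot_eq0; apply/eqP; rewrite eq_le dot_ge0 andbT.
      by rewrite (le_trans (SN _ (leqnn T))) // eT0 mulr0 expr0n.
    by rewrite eT0 !dot0l oppr0 !mul0r addr0.
  have eT_gt0 : 0 < e T by rewrite lt_neqAle eq_sym eTn0 e0.
  (* Completing the square. *)
  rewrite -subr_ge0.
  have -> : dot (S T) (S T) / (2 * e T) + e T * (dot u u / 2) - - dot (S T) u =
      dot (S T + e T *: u) (S T + e T *: u) / (2 * e T).
    by rewrite !dotE (dotC u); field.
  by rewrite divr_ge0 ?dot_ge0 ?mulr_ge0.
have -> : \sum_(t < T) dot (l t) (w t - u) =
    \sum_(t < T) dot (l t) (w t) - dot (S T) u.
  by rewrite dot_suml -sumrB; apply: eq_bigr => t _; rewrite dotDr dotNr.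
have := potential T (leqnn T).
have : Num.min (e T) (3 / 2 * B) <= 3 / 2 * B by rewrite ge_min lexx orbT.
move/(ler_wpM2l N0).
have : e T * (dot u u / 2) <= B * N * (dot u u / 2).
  by rewrite ler_wpM2r // divr_ge0 ?dot_ge0.
lra.
Qed.

End Regret.

(** * Lagrangian duality and the dual gap of the averaged iterates *)

Section Duality.
Context {R : realType} {m n d : nat}.
Context (X : 'I_m -> set 'rV[R]_d) (Y : 'I_n -> set 'rV[R]_d).
Context (f : 'I_m -> 'rV[R]_d -> R) (g : 'I_n -> 'rV[R]_d -> R).
Implicit Types (z w : profile R m n d) (lam mu : 'rV[R]_d).

(** The violation of the coupling constraint; at [ztilde] it is convertible to [Delta_ztilde]. *)
Definition residual z : 'rV[R]_d := \sum_(j < n) z.2 j - \sum_(i < m) z.1 i.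

Definition lagrangian z lam : R := objF f g z + dot lam (residual z).

(** The Q of the overview; unit weights give the squared Euclidean distance on the product. *)
Definition wdist2 (s1 : 'I_m -> R) (s2 : 'I_n -> R) z w : R :=
  \sum_(i < m) s1 i * dot (z.1 i - w.1 i) (z.1 i - w.1 i) +
  \sum_(j < n) s2 j * dot (z.2 j - w.2 j) (z.2 j - w.2 j).

(** The Lagrangian separates over the blocks, so blockwise maximizers maximize it jointly. *)
Lemma lagrangianE z lam :
  lagrangian z lam = \sum_(i < m) (f i (z.1 i) - dot lam (z.1 i)) +
                     \sum_(j < n) (dot lam (z.2 j) - g j (z.2 j)).
Proof.
rewrite /lagrangian /objF /residual dotDr dotNr !dot_sumr !big_split /= !sumrN.
ring.
Qed.

Lemma lagrangianD z lam mu :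
  lagrangian z mu = lagrangian z lam + dot (mu - lam) (residual z).
Proof. by rewrite /lagrangian dotDl dotNl; ring. Qed.

(** The residual is a signed sum of [m + n] blocks, so [dot_sum_le] applies over the disjoint union
    of the index types. This serves both the Lipschitz gradient of the dual and the bound on
    [Delta_ztilde]. *)
Lemma residual_dist2 s1 s2 z w :
  (forall i, 0 < s1 i) -> (forall j, 0 < s2 j) ->
  dot (residual z - residual w) (residual z - residual w) <=
    kappa s1 s2 * wdist2 s1 s2 z w.
Proof.
move=> s1_gt0 s2_gt0.
pose s (k : 'I_m + 'I_n) := match k with inl i => s1 i | inr j => s2 j end.
pose v (k : 'I_m + 'I_n) : 'rV[R]_d :=
  match k with inl i => - (z.1 i - w.1 i) | inr j => z.2 j - w.2 j end.
have s_gt0 k : 0 < s k by case: k => ?; [exact: s1_gt0 | exact: s2_gt0].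
have := dot_sum_le v s_gt0.
have -> : \sum_k v k = residual z - residual w.
  rewrite big_sumType /= sumrN !sumrB /residual !opprB.
  by rewrite addrC addrACA [RHS]addrACA [- _ - _]addrC.
rewrite !big_sumType /= -/(kappa s1 s2).
by under [X in _ * (X + _)]eq_bigr => i _ do rewrite dotNl dotNr opprK.
Qed.

(** Blockwise Lipschitz bounds, then Cauchy-Schwarz between the constants and the block
    distances. *)
Lemma objF_lipschitz K1 K2 z w :
  (forall i, elipschitz_on (K1 i) (X i) (f i)) ->
  (forall j, elipschitz_on (K2 j) (Y j) (g j)) ->
  Zset X Y z -> Zset X Y w ->
  objF f g z - objF f g w <=
    Kconst K1 K2 * Num.sqrt (wdist2 (fun=> 1) (fun=> 1) z w).
Proof.
move=> flip glip [Xz Yz] [Xw Yw].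
pose K (k : 'I_m + 'I_n) := match k with inl i => K1 i | inr j => K2 j end.
pose v (k : 'I_m + 'I_n) :=
  match k with inl i => enorm (z.1 i - w.1 i) | inr j => enorm (z.2 j - w.2 j) end.
have := cauchy_schwarz K v; rewrite !big_sumType /=.
under [X in _ <= _ * (X + _)]eq_bigr => i _ do
  rewrite sqr_enorm -[dot _ _]mul1r.
under [X in _ <= _ * (_ + X)]eq_bigr => i _ do
  rewrite sqr_enorm -[dot _ _]mul1r.
rewrite -/(wdist2 _ _ z w) => /le_sqrtr_sqr; rewrite sqrtrM; last first.
  by rewrite addr_ge0 // sumr_ge0 // => k _; rewrite sqr_ge0.
apply: le_trans.
have -> : objF f g z - objF f g w =
    \sum_(i < m) (f i (z.1 i) - f i (w.1 i)) +
    \sum_(j < n) (g j (w.2 j) - g j (z.2 j)).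
  by rewrite /objF !sumrB; ring.
rewrite lerD // ler_sum // => k _; rewrite (le_trans (ler_norm _)) ?flip //.
by rewrite distrC glip.
Qed.

Lemma wdist2_scale s1 s2 (a : R) z w :
  (forall i, a <= s1 i) -> (forall j, a <= s2 j) ->
  a * wdist2 (fun=> 1) (fun=> 1) z w <= wdist2 s1 s2 z w.
Proof.
move=> as1 as2; rewrite mulrDr !mulr_sumr.
by rewrite lerD // ler_sum // => k _; rewrite mul1r ler_wpM2r ?dot_ge0.
Qed.

Context (s1 : 'I_m -> R) (s2 : 'I_n -> R) (K1 : 'I_m -> R) (K2 : 'I_n -> R).
Context (s1_gt0 : forall i, 0 < s1 i) (s2_gt0 : forall j, 0 < s2 j).
Context (X_neq0 : forall i, X i !=set0) (Y_neq0 : forall j, Y j !=set0).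
Context (X_convex : forall i, convex_set (X i)).
Context (Y_convex : forall j, convex_set (Y j)).
Context (X_compact : forall i, compact (X i)).
Context (Y_compact : forall j, compact (Y j)).
Context (f_concave : forall i, strongly_concave_on (s1 i) (X i) (f i)).
Context (g_convex : forall j, strongly_convex_on (s2 j) (Y j) (g j)).
Context (f_lip : forall i, elipschitz_on (K1 i) (X i) (f i)).
Context (g_lip : forall j, elipschitz_on (K2 j) (Y j) (g j)).

Local Notation zt := (ztilde X Y f g).

Lemma wdist2_ge0 z w : 0 <= wdist2 s1 s2 z w.
Proof.
by rewrite addr_ge0 // sumr_ge0 // => k _; rewrite mulr_ge0 ?dot_ge0 ?ltW.
Qed.

Lemma xtilde_maximizer lam i :
  is_maximizer (X i) (fun x => f i x - dot lam x) (xtilde X f lam i).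
Proof.
exact: (compact_maximizer (X_neq0 i) (@X_compact i)
         (elipschitz_subl lam (@f_lip i))).
Qed.

Lemma ytilde_maximizer lam j :
  is_maximizer (Y j) (fun y => dot lam y - g j y) (ytilde Y g lam j).
Proof.
exact: (compact_maximizer (Y_neq0 j) (@Y_compact j)
         (elipschitz_subr lam (@g_lip j))).
Qed.

Lemma ztilde_Zset lam : Zset X Y (zt lam).
Proof.
by split=> k; [case: (xtilde_maximizer lam k) | case: (ytilde_maximizer lam k)].
Qed.

(** [maximizer_gap] summed over the blocks; the linear terms do not change the moduli. *)
Lemma lagrangian_gap lam z :
  Zset X Y z ->
  lagrangian z lam + wdist2 s1 s2 z (zt lam) / 2 <= lagrangian (zt lam) lam.
Proof.
move=> [Xz Yz]; rewrite addrC -lerBrDr !lagrangianE /wdist2.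
rewrite opprD addrACA -!sumrB mulrDl !mulr_suml lerD // ler_sum // => k _.
- rewrite mulrAC; apply: (maximizer_gap (A := X k) (h := fun x => f k x - dot lam x)) => //.
  + exact: ltW.
  + exact: strongly_concave_subl.
  + exact: xtilde_maximizer.
- rewrite mulrAC; apply: (maximizer_gap (A := Y k) (h := fun x => dot lam x - g k x)) => //.
  + exact: ltW.
  + exact: strongly_convex_subl.
  + exact: ytilde_maximizer.
Qed.

Lemma lagrangian_le lam z :
  Zset X Y z -> lagrangian z lam <= lagrangian (zt lam) lam.
Proof.
move/(lagrangian_gap lam); have := wdist2_ge0 z (zt lam); lra.
Qed.

Lemma dualGE lam : dualG X Y f g lam = lagrangian (zt lam) lam.
Proof.
have valE z : objF f g z + \sum_(j < n) dot lam (z.2 j) -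
    \sum_(i < m) dot lam (z.1 i) = lagrangian z lam.
  by rewrite /lagrangian /residual dotDr dotNr !dot_sumr addrA.
have ub : ubound [set objF f g z + \sum_(j < n) dot lam (z.2 j)
           - \sum_(i < m) dot lam (z.1 i) | z in Zset X Y]
    (lagrangian (zt lam) lam).
  by move=> _ [z Zz <-]; rewrite valE lagrangian_le.
have mem : [set objF f g z + \sum_(j < n) dot lam (z.2 j)
           - \sum_(i < m) dot lam (z.1 i) | z in Zset X Y]
    (lagrangian (zt lam) lam).
  by exists (zt lam); [exact: ztilde_Zset | exact: valE].
apply/eqP; rewrite eq_le; apply/andP; split.
  by apply: ge_sup => //; eexists; exact: mem.
by apply: ub_le_sup => //; eexists; exact: ub.
Qed.

(** The point [ztilde(lam)] is a competitor in the maximum defining [G(mu)], and the Lagrangian is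
    affine in the multiplier. *)
Lemma dualG_subgradient lam mu :
  dualG X Y f g lam - dualG X Y f g mu <= dot (Delta_ztilde X Y f g lam) (lam - mu).
Proof.
rewrite !dualGE; have := lagrangian_le mu (ztilde_Zset lam).
rewrite (lagrangianD (zt lam) lam mu) -[residual _]/(Delta_ztilde X Y f g lam).
rewrite (dotC (mu - lam)) -[lam - mu]opprB dotNr; lra.
Qed.

Lemma kappa_gt0 : (0 < m)%N -> 0 < kappa s1 s2.
Proof.
move=> m0; rewrite ltr_pwDl ?sumr_ge0 // => [|j _]; last by rewrite invr_ge0 ltW.
rewrite (bigD1 (Ordinal m0)) //= ltr_pwDl ?invr_gt0 // sumr_ge0 // => i _.
by rewrite invr_ge0 ltW.
Qed.

(* The gradient step [mu = lam - Delta / kappa] decreases [dualG] by at least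
   [|Delta|^2 / (2 kappa)], because the gradient is kappa-Lipschitz. *)
Lemma dual_optimal_feasible lam :
  (0 < m)%N -> (forall mu, dualG X Y f g lam <= dualG X Y f g mu) ->
  Delta_ztilde X Y f g lam = 0.
Proof.
move=> m0 lam_opt; have k0 := kappa_gt0 m0.
set D := Delta_ztilde X Y f g lam; set k := kappa s1 s2 in k0.
pose mu := lam - k^-1 *: D.
pose w := Delta_ztilde X Y f g mu - D.
have := lam_opt mu; rewrite !dualGE.
have := lagrangian_gap lam (ztilde_Zset mu).
have := residual_dist2 (zt mu) (zt lam) s1_gt0 s2_gt0.
rewrite -/k -[residual (zt lam)]/D -[residual (zt mu) - D]/w.
rewrite (lagrangianD (zt mu) lam mu) -[residual (zt mu)]/(Delta_ztilde X Y f g mu).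
have -> : Delta_ztilde X Y f g mu = D + w by rewrite /w addrC subrK.
have -> : mu - lam = - (k^-1 *: D) by rewrite /mu addrC addKr.
rewrite dotNl dotZl dotDr; set Q := wdist2 _ _ _ _ => wQ gap opt.
have ki : 0 < k^-1 by rewrite invr_gt0.
have {}wQ : k^-1 * dot w w <= Q by rewrite mulrC ler_pdivrMr // mulrC.
(* Optimality and the gap give [|D|^2 + <D, w> + |w|^2 / 2 <= 0] after scaling by [k]. The left side
   exceeds [|D + w|^2 / 2] by [|D|^2 / 2]. *)
have : 0 <= k^-1 * dot (D + w) (D + w) by rewrite mulr_ge0 ?dot_ge0 ?ltW.
rewrite dotDl !(dotDr _ D w) (dotC w D) => sq.
have DD : k^-1 * dot D D <= 0 by lra.
by apply: dot_eq0; apply/eqP; rewrite eq_le dot_ge0 andbT -(pmulr_rle0 _ ki).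
Qed.

(** By feasibility of [ztilde(lam)], [G(lam) = F(ztilde(lam)) <= F(z)]. As [z] has zero residual,
    [F(z)] is also its Lagrangian at [mu], where [lagrangian_gap] applies. *)
Lemma duality_gap z lam mu :
  (0 < m)%N -> is_maximizer (Sset X Y) (objF f g) z ->
  (forall nu, dualG X Y f g lam <= dualG X Y f g nu) ->
  wdist2 s1 s2 z (zt mu) / 2 <= dualG X Y f g mu - dualG X Y f g lam.
Proof.
move=> m0 [[Zz res0] zopt] lam_opt.
have D0 := dual_optimal_feasible m0 lam_opt.
have Slam : Sset X Y (zt lam).
  by split; [exact: ztilde_Zset | apply/esym/eqP; rewrite -subr_eq0; exact/eqP].
have := zopt _ Slam; have := lagrangian_gap mu Zz.
rewrite !dualGE {1}/lagrangian /residual res0 subrr dot0r.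
rewrite /lagrangian -[residual (zt lam)]/(Delta_ztilde X Y f g lam) D0 dot0r.
lra.
Qed.

(** Each [G(nu t)] is bounded below by the Lagrangian at the single point [ztilde(avg)], which is
    affine in the multiplier. *)
Lemma dualG_jensen (T : nat) (nu : nat -> 'rV[R]_d) mu :
  (0 < T)%N ->
  T%:R * (dualG X Y f g (T%:R^-1 *: \sum_(t < T) nu t) - dualG X Y f g mu) <=
    \sum_(t < T) (dualG X Y f g (nu t) - dualG X Y f g mu).
Proof.
move=> T0; rewrite sumrB mulrBr sumr_const card_ord -(mulr_natl (dualG X Y f g mu)) lerD2r.
set avg := _ *: _.
have Tn0 : T%:R != 0 :> R by rewrite pnatr_eq0 -lt0n.
apply: (@le_trans _ _ (\sum_(t < T) lagrangian (zt avg) (nu t))); last first.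
  by apply: ler_sum => t _; rewrite dualGE lagrangian_le //; exact: ztilde_Zset.
rewrite dualGE /lagrangian big_split /= sumr_const card_ord -dot_suml.
by rewrite mulrDr -(mulr_natl (objF _ _ _)) -dotZl /avg scalerA mulfV // scale1r.
Qed.

(** Each coordinate is a difference of numbers in [[0, n c]] and [[0, m c]]; there are [d]
    coordinates. *)
Lemma Delta_ztilde_le (c : R) lam :
  0 <= c -> (forall i, X i `<=` cube c) -> (forall j, Y j `<=` cube c) ->
  dot (Delta_ztilde X Y f g lam) (Delta_ztilde X Y f g lam) <=
    ((m + n)%:R * c * Num.sqrt d%:R) ^+ 2.
Proof.
move=> c0 Xc Yc; have [Xz Yz] := ztilde_Zset lam.
rewrite exprMn sqr_sqrtr // mulr_natr -[d in leRHS]card_ord -sumr_const.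
apply: ler_sum => k _; rewrite -expr2 -real_normK ?num_real //.
rewrite ler_sqr ?nnegrE ?mulr_ge0 // /Delta_ztilde !mxE !summxE.
have bound p (u : 'I_p -> R) : (forall i, 0 <= u i <= c) ->
    0 <= \sum_i u i <= p%:R * c.
  move=> uc; rewrite sumr_ge0 => [|i _]; last by case/andP: (uc i).
  rewrite (@le_trans _ _ (\sum_(i < p) c)) //.
    by apply: ler_sum => i _; case/andP: (uc i).
  by rewrite sumr_const card_ord mulr_natl.
have /andP[y0 yc] := bound _ _ (fun j => Yc j _ (Yz j) k).
have /andP[x0 xc] := bound _ _ (fun i => Xc i _ (Xz i) k).
rewrite ler_norml natrD; move: x0 xc y0 yc => /=.
have : 0 <= m%:R * c by rewrite mulr_ge0.
have : 0 <= n%:R * c by rewrite mulr_ge0.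
lra.
Qed.

Lemma ftrl_dualG_gap (c : R) lam nu (T : nat) :
  0 <= c -> (forall i, X i `<=` cube c) -> (forall j, Y j `<=` cube c) ->
  solo_ftrl X Y f g nu -> (0 < T)%N ->
  dualG X Y f g (average nu T) - dualG X Y f g lam <=
    (m + n)%:R * c * (enorm lam ^+ 2 + 25 / 2) / 2 * (Num.sqrt d%:R / Num.sqrt T%:R).
Proof.
move=> c0 Xc Yc [nu1 nuE] T0.
(* The iterates are numbered from 1, the losses of [ftrl_regret] from 0. *)
pose l t := Delta_ztilde X Y f g (nu t.+1).
have nuS t : nu t.+1 = - ((Num.sqrt (\sum_(i < t) dot (l i) (l i)))^-1 *:
    \sum_(i < t) l i).
  (* At [t = 0] the empty sum of losses is 0, in agreement with the initial iterate. *)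
  case: t => [|t]; first by rewrite nu1 !big_ord0 scaler0 oppr0.
  rewrite nuE // !big_add1 /= !big_mkord.
  by congr (- ((Num.sqrt _)^-1 *: _)); apply: eq_bigr => i _; rewrite sqr_enorm.
have := @ftrl_regret _ _ l (fun t => nu t.+1) T _ lam _
  (fun t => Delta_ztilde_le (nu t.+1) c0 Xc Yc) nuS.
move=> /(_ (mulr_ge0 (mulr_ge0 (ler0n _ _) c0) (sqrtr_ge0 _))).
set B := _ * Num.sqrt d%:R => regret.
have T_gt0 : 0 < T%:R :> R by rewrite ltr0n.
have sT_gt0 : 0 < Num.sqrt T%:R :> R by rewrite sqrtr_gt0.
have := dualG_jensen (fun t => nu t.+1) lam T0.
rewrite /average big_add1 big_mkord /=; set gap := _ - _ => jensen.
have : \sum_(t < T) (dualG X Y f g (nu t.+1) - dualG X Y f g lam)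
    <= \sum_(t < T) dot (l t) (nu t.+1 - lam).
  by apply: ler_sum => t _; exact: dualG_subgradient.
move=> /(le_trans jensen)/le_trans/(_ regret).
rewrite -sqr_enorm -[in T%:R * gap](sqr_sqrtr (ltW T_gt0)) => le1.
set sT := Num.sqrt T%:R in sT_gt0 le1 *.
(* As [T = sT^2], one factor [sT] cancels. *)
have {le1} : sT * gap <= B * (enorm lam ^+ 2 / 2 + 5).
  by rewrite -(ler_pM2l sT_gt0); move: le1; rewrite expr2; lra.
rewrite mulrA ler_pdivlMr // mulrC => /le_trans; apply.
(* The regret constant 5 lies below 25/4, half of the 25/2 claimed. *)
have : 0 <= B by rewrite /B !mulr_ge0 ?sqrtr_ge0.
rewrite /B; lra.
Qed.

End Duality.

(** * Constants and the two final bounds *)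

Lemma family_min_gt0 (R : realType) k (hk : (0 < k)%N) (s : 'I_k -> R) :
  (forall i, 0 < s i) -> 0 < family_min hk s.
Proof. by move=> s0; apply: lt_bigmin. Qed.

Lemma powR_quarter (R : realType) (k : nat) :
  (k%:R : R) `^ (1 / 4) = Num.sqrt (Num.sqrt k%:R).
Proof.
have -> : 1 / 4 = 2^-1 * 2^-1 :> R by field.
by rewrite powRrM powR12_sqrt // powR12_sqrt.
Qed.

Theorem theorem3 (R : realType) (m n d : nat)
  (hm : (0 < m)%N) (hn : (0 < n)%N) (hd : (0 < d)%N)
  (X : 'I_m -> set 'rV[R]_d) (Y : 'I_n -> set 'rV[R]_d)
  (f : 'I_m -> 'rV[R]_d -> R) (g : 'I_n -> 'rV[R]_d -> R)
  (eps c : R) (s1 : 'I_m -> R) (s2 : 'I_n -> R)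
  (K1 : 'I_m -> R) (K2 : 'I_n -> R)
  (heps : 0 < eps) (hc : 0 < c)
  (X_convex : forall i, convex_set (X i))
  (Y_convex : forall j, convex_set (Y j))
  (X_compact : forall i, compact (X i))
  (Y_compact : forall j, compact (Y j))
  (X_orthant : forall i, X i `<=` orthant (R:=R) (d:=d))
  (Y_orthant : forall j, Y j `<=` orthant (R:=R) (d:=d))
  (X_cubes : forall i, cube eps `<=` X i /\ X i `<=` cube c)
  (Y_cubes : forall j, cube eps `<=` Y j /\ Y j `<=` cube c)
  (f_ge0 : forall i x, X i x -> 0 <= f i x)
  (g_ge0 : forall j y, Y j y -> 0 <= g j y)
  (s1_gt0 : forall i, 0 < s1 i)
  (s2_gt0 : forall j, 0 < s2 j)
  (f_concave : forall i, strongly_concave_on (s1 i) (X i) (f i))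
  (g_convex : forall j, strongly_convex_on (s2 j) (Y j) (g j))
  (f_ndecr : forall i, nondecreasing_in_each_arg (X i) (f i))
  (g_ndecr : forall j, nondecreasing_in_each_arg (Y j) (g j))
  (f0 : forall i, f i 0 = 0)
  (g0 : forall j, g j 0 = 0)
  (f_lip : forall i, elipschitz_on (K1 i) (X i) (f i))
  (g_lip : forall j, elipschitz_on (K2 j) (Y j) (g j))
  (zstar : profile R m n d)
  (zstar_opt : is_maximizer (Sset X Y) (objF f g) zstar)
  (lamstar : 'rV[R]_d)
  (lamstar_opt : forall lam, dualG X Y f g lamstar <= dualG X Y f g lam)
  (lam : nat -> 'rV[R]_d)
  (lam_ftrl : solo_ftrl X Y f g lam) :
  forall T : nat, (1 <= T)%N ->
    objF f g zstar - objF f g (ztilde X Y f g (average lam T)) <=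
      Kconst K1 K2 * Num.sqrt ((m + n)%:R * c / sigma_min hm hn s1 s2) *
      Num.sqrt (enorm lamstar ^+ 2 + 25 / 2) *
      (d%:R `^ (1 / 4) / T%:R `^ (1 / 4))
    /\
    enorm (Delta_ztilde X Y f g (average lam T)) <=
      Num.sqrt (kappa s1 s2 * (m + n)%:R * c) *
      Num.sqrt (enorm lamstar ^+ 2 + 25 / 2) *
      (d%:R `^ (1 / 4) / T%:R `^ (1 / 4)).
Proof.
move=> T T1.
have X_neq0 i : X i !=set0.
  by exists 0; apply: (X_cubes i).1 => k; rewrite mxE lexx ltW.
have Y_neq0 j : Y j !=set0.
  by exists 0; apply: (Y_cubes j).1 => k; rewrite mxE lexx ltW.
have Zstar : Zset X Y zstar by case: zstar_opt => -[].
set avg := average lam T; set zavg := ztilde X Y f g avg.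
have Zavg : Zset X Y zavg.
  exact: (ztilde_Zset X_neq0 Y_neq0 X_compact Y_compact f_lip g_lip).
have gap := duality_gap s1_gt0 s2_gt0 X_neq0 Y_neq0 X_convex Y_convex
  X_compact Y_compact f_concave g_convex f_lip g_lip avg hm zstar_opt
  lamstar_opt.
have := ftrl_dualG_gap s1_gt0 s2_gt0 X_neq0 Y_neq0 X_convex Y_convex X_compact
  Y_compact f_concave g_convex f_lip g_lip lamstar (ltW hc)
  (fun i => (X_cubes i).2) (fun j => (Y_cubes j).2) lam_ftrl T1.
rewrite !powR_quarter -/avg.
(* With the quarter powers as nested roots, each bound becomes a comparison under one square
   root. *)
have -> : Num.sqrt (Num.sqrt d%:R) / Num.sqrt (Num.sqrt T%:R) =
    Num.sqrt (Num.sqrt d%:R / Num.sqrt T%:R) :> R.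
  by rewrite -sqrtrV ?sqrtr_ge0 // -sqrtrM ?sqrtr_ge0.
set r := Num.sqrt d%:R / Num.sqrt T%:R; set L := enorm lamstar ^+ 2 + 25 / 2.
set C := (m + n)%:R * c => avg_gap.
have C0 : 0 <= C by rewrite mulr_ge0 // ltW.
have L0 : 0 <= L by rewrite addr_ge0 ?sqr_ge0.
(* The factors 1/2 in the duality gap and in the regret bound cancel. *)
have W_le : wdist2 s1 s2 zstar zavg <= C * L * r by move: gap; rewrite -/zavg; lra.
split.
  set s := sigma_min hm hn s1 s2.
  have s_gt0 : 0 < s by rewrite lt_min !family_min_gt0.
  apply: (le_trans (objF_lipschitz f_lip g_lip Zstar Zavg)).
  rewrite -[leRHS]mulrA -[leRHS]mulrA ler_wpM2l ?sqrtr_ge0 //.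
  rewrite -sqrtrM // -sqrtrM ?divr_ge0 ?(ltW s_gt0) // ler_wsqrtr //.
  (* Lowering every modulus to the minimum [s] turns the weighted distance into [s] times the plain
     one. *)
  have -> : C / s * (L * r) = C * L * r / s by field; rewrite gt_eqF.
  rewrite ler_pdivlMr // mulrC; apply: le_trans W_le.
  by apply: wdist2_scale => k; rewrite ge_min bigmin_le ?orbT.
have k0 : 0 <= kappa s1 s2 by rewrite ltW // kappa_gt0.
rewrite -[leRHS]mulrA -sqrtrM // -sqrtrM; last by rewrite -mulrA mulr_ge0.
rewrite ler_wsqrtr //.
(* Since [zstar] is feasible, the residual difference is minus [Delta_ztilde] at the average. *)
have := residual_dist2 zstar zavg s1_gt0 s2_gt0.
have -> : residual zstar = 0.
  by case: zstar_opt => -[_ res0] _; rewrite /residual res0 subrr.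
rewrite sub0r dotNl dotNr opprK => /le_trans; apply.
have -> : kappa s1 s2 * (m + n)%:R * c * (L * r) = kappa s1 s2 * (C * L * r).
  by rewrite /C; ring.
by rewrite ler_wpM2l.
Qed.
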